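(* Let $d\in\mathbb N$, let $p$ satisfy $1<p\le 4/3$, $p=2$, or $4\le p<\infty$, let $\mathcal S\subseteq\mathcal M_d$ be bounded with respect to the Schatten $p$-norm, and let $A\in\operatorname{conv}(\mathcal S)$. Then there exists a sequence $(X_i)_{i\ge1}\subseteq\mathcal S$ such that, with $A_k=\frac1k\sum_{i=1}^k X_i$, for every $k\ge1$: (a) if $1<p\le4/3$: $\displaystyle \|A-A_k\|_p\le \frac{2e^2}{p^{1/p}}\,k^{1/p-1}\,\operatorname{diam}(\mathcal S)$; (b) if $p=2$ or $4\le p<\infty$: $\displaystyle \|A-A_k\|_p\le e^2\sqrt{\frac{2(p-1)}{k}}\,\operatorname{diam}(\mathcal S)$.
   Context: $\mathcal M_d$ denotes the complex $d\times d$ matrices with the (unnormalised) Schatten $p$-norm $\|A\|_p=(\sum_i s_i(A)^p)^{1/p}$, $s_i(A)$ the singular values. $\operatorname{diam}(\mathcal S)=\sup\{\|X-Y\|_p: X,Y\in\mathcal S\}$. *)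

(* Defs.v *)
From HB Require Import structures.
From mathcomp Require Import all_boot all_order all_algebra.
From mathcomp Require Import all_classical all_reals.
From mathcomp Require Import sequences exp.
From mathcomp Require Import complex.
Set Implicit Arguments. Unset Strict Implicit. Unset Printing Implicit Defensive.
Import Order.TTheory GRing.Theory Num.Theory.
Local Open Scope ring_scope.
Local Open Scope classical_set_scope.

Section Schatten.
Variables (R : realType) (d : nat).

Definition adjmx (A : 'M[R[i]]_d) : 'M[R[i]]_d := (map_mx conjc A)^T.

Definition is_singular_values (A : 'M[R[i]]_d) (s : seq R) : Prop :=
  (forall x, x \in s -> 0 <= x) /\
  char_poly (adjmx A *m A) =
    \prod_(x <- s) ('X - (real_complex R (x ^+ 2))%:P).

(* the singular values s_1(A), ..., s_d(A) (they exist and are unique up to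
   order, which is irrelevant below) *)
Definition singular_values (A : 'M[R[i]]_d) : seq R :=
  xget [::] (is_singular_values A).

Definition schatten (p : R) (A : 'M[R[i]]_d) : R :=
  (\sum_(x <- singular_values A) x `^ p) `^ p^-1.

Definition conv (S : set 'M[R[i]]_d) : set 'M[R[i]]_d :=
  [set A | exists (n : nat) (w : 'I_n -> R) (X : 'I_n -> 'M[R[i]]_d),
     (forall j, S (X j)) /\ (forall j, 0 <= w j) /\ \sum_j w j = 1 /\
     A = \sum_j real_complex R (w j) *: X j].

Definition schatten_bounded (p : R) (S : set 'M[R[i]]_d) : Prop :=
  exists M : R, forall X, S X -> schatten p X <= M.

Definition diam (p : R) (S : set 'M[R[i]]_d) : R :=
  sup [set schatten p (X - Y) | X in S & Y in S].

End Schatten.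

(* Main.v *)
Require Import Defs.
From HB Require Import structures.
From mathcomp Require Import all_boot all_order all_algebra.
From mathcomp Require Import all_classical all_reals.
From mathcomp Require Import sequences exp.
From mathcomp Require Import complex.
From mathcomp Require Import ring lra.
Set Implicit Arguments. Unset Strict Implicit. Unset Printing Implicit Defensive.
Import Order.TTheory GRing.Theory Num.Theory.
Local Open Scope ring_scope.
Local Open Scope classical_set_scope.

(* The greedy sequence X_(k+1) is chosen in S so that the gradient of the p-th
   power of the Schatten norm at B_k = sum_(i <= k) (X_i - A) is nonpositive in the
   direction X_(k+1) - A; such a point exists because A is a convex combination of
   points of S. The inequalities bounding the growth of B_k are proved for the trace
   functional tr |H|^p of Hermitian matrices H and transferred to arbitrary matrices
   through the dilation [[0, A], [A^*, 0]], for which it equals 2 ||A||_p^p.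

   If A, B are Hermitian with eigenbases (u_i), (v_j) and eigenvalues a_i, b_j, then
   tr g(A) h(B) = sum_ij g(a_i) h(b_j) |<u_i, v_j>|^2, so that trace inequalities
   reduce to inequalities between real numbers.
   - For p >= 2, (f(a) - f(b)) (a - b) <= (p - 1) (|a|^(p-2) + |b|^(p-2)) (a - b)^2 with
     f(t) = t |t|^(p-2), together with Hoelder, bounds the second-order remainder.
   - For p < 2 the remainder is bounded by the Clarkson-McCarthy inequality, itself a
     consequence of the parallelogram identity and of Rotfel'd's inequality
     tr (X^2 + Y^2)^q <= tr X^(2q) + tr Y^(2q) for q = p / 2 < 1. *)

(** * Real inequalities for powers *)

Section ScalarInequalities.
Variable (R : realType).
Implicit Types (a b p q r u x y z : R).

(** Young's inequality for the product [u * 1] with exponents [r] and [r / (r - 1)], rearranged. *)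
Lemma bernoulli_powR r u : 1 <= r -> 0 <= u -> 1 + r * (u - 1) <= u `^ r.
Proof.
rewrite le_eqVlt => /predU1P[<- u0|r1 u0].
  by rewrite powRr1 // mul1r addrC subrK.
have r0 : 0 < r by apply: lt_trans r1.
have rn0 : r != 0 by rewrite gt_eqF.
have rm0 : 0 < r - 1 by rewrite subr_gt0.
have rmn0 : r - 1 != 0 by rewrite gt_eqF.
have s0 : 0 < r / (r - 1) by rewrite divr_gt0.
have := @conjugate_powR _ u 1 r (r / (r - 1)) u0 ler01 r0 s0.
rewrite powR1 mulr1 mul1r invf_div => /(_ _).
have -> : r^-1 + (r - 1) / r = 1 by field.
move=> /(_ erefl); rewrite -mulrDl ler_pdivlMr // => h; lra.
Qed.

(** Bernoulli with exponent [1 / q] at the point [1 + q * (u - 1)], followed by taking [q]-th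
    powers. *)
Lemma powR_le_tangent q u : 0 < q -> q <= 1 -> 0 <= u ->
  u `^ q <= 1 + q * (u - 1).
Proof.
move=> q0 q1 u0.
have h0 : 0 <= 1 + q * (u - 1) by nra.
have hq : 1 <= q^-1 by rewrite invf_ge1.
have := bernoulli_powR hq h0.
have -> : 1 + q^-1 * (1 + q * (u - 1) - 1) = u by field; rewrite gt_eqF.
move=> /(ge0_ler_powR (ltW q0)) h; apply: le_trans (h _ _) _.
- by rewrite nnegrE.
- by rewrite nnegrE powR_ge0.
by rewrite -powRrM mulVf ?gt_eqF // powRr1.
Qed.

(** The derivative of [|a|^p / p]; the factor [a] forces the value 0 at [a = 0], whatever the sign
    of [p - 2]. *)
Definition sgnpow p a : R := a * `|a| `^ (p - 2).

Lemma sgnpowM p a : p != 0 -> sgnpow p a * a = `|a| `^ p.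
Proof.
move=> p0; rewrite /sgnpow.
have [->|a0] := eqVneq a 0; first by rewrite mulr0 normr0 powR0.
have -> : a * `|a| `^ (p - 2) * a = `|a| ^+ 2 * `|a| `^ (p - 2).
  by rewrite real_normK ?num_real //; ring.
rewrite -powR_mulrn // -powRD ?normr_eq0 ?a0 ?implybT //.
by congr (_ `^ _); ring.
Qed.

Lemma powR_norm_tangent p a b : 1 <= p ->
  `|a| `^ p + p * (sgnpow p a * (b - a)) <= `|b| `^ p.
Proof.
move=> p1; have p0 : p != 0 by rewrite gt_eqF // (lt_le_trans ltr01).
have [->|a0] := eqVneq a 0.
  by rewrite /sgnpow mul0r mul0r mulr0 addr0 normr0 powR0 // powR_ge0.
have h := bernoulli_powR p1 (normr_ge0 (b / a)).
have hb : b = a * (b / a) by field.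
rewrite (_ : b - a = a * (b / a - 1)); last by rewrite mulrBr -hb mulr1.
rewrite (mulrA (sgnpow _ _)) sgnpowM // [in leRHS]hb normrM powRM //.
apply: le_trans (ler_wpM2l (powR_ge0 _ _) h).
rewrite [leRHS]mulrDr mulr1 lerD2l mulrCA ler_wpM2l ?powR_ge0 //.
rewrite ler_wpM2l ?(le_trans ler01) // lerD2r; exact: ler_norm.
Qed.

(** The tangent of the concave [q]-th power at the mean [mu] lies above the graph, and its linear
    part averages to zero. *)
Lemma powR_jensen (I : finType) (c m : I -> R) q :
  0 < q -> q <= 1 -> (forall i, 0 <= c i) -> (forall i, 0 <= m i) ->
  \sum_i c i = 1 ->
  \sum_i m i `^ q * c i <= (\sum_i m i * c i) `^ q.
Proof.
move=> q0 q1 c0 m0 c1; set mu := (X in _ <= X `^ _).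
have mu0 : 0 <= mu by apply: sumr_ge0 => i _; rewrite mulr_ge0.
have qn0 : q != 0 by rewrite gt_eqF.
(* A zero mean admits no tangent; then each index has zero value or zero weight. *)
move: mu0; rewrite le_eqVlt => /predU1P[mu0|mu0].
  rewrite -mu0 powR0 // big1 // => i _.
  have /eqP := esym mu0; rewrite psumr_eq0 => [|j _]; last by rewrite mulr_ge0.
  move=> /allP /(_ i (mem_index_enum _)) /=; rewrite mulf_eq0 => /orP[]/eqP->.
    by rewrite powR0 // mul0r.
  by rewrite mulr0.
have mun0 : mu != 0 by rewrite gt_eqF.
apply: (@le_trans _ _ (\sum_i mu `^ q * ((1 - q) * c i + q / mu * (m i * c i)))).
  apply: ler_sum => i _.
  have -> : mu `^ q * ((1 - q) * c i + q / mu * (m i * c i)) =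
     (mu `^ q * (1 + q * (m i / mu - 1))) * c i by field.
  apply: ler_wpM2r => //.
  rewrite {1}(_ : m i = mu * (m i / mu)); last by field.
  rewrite powRM ?divr_ge0 // ?(ltW mu0) // ler_wpM2l ?powR_ge0 //.
  by apply: powR_le_tangent; rewrite ?divr_ge0 // ltW.
rewrite -mulr_sumr big_split /= -!mulr_sumr c1 -/mu -mulrA mulVf // mulr1.
by rewrite mulr1 subrK mulr1.
Qed.

(** Take [|b| <= |a|]. For opposite signs the bound holds already without the factor [p - 1], by
    expansion. Otherwise [b = a * u] with [0 <= u <= 1], and the claim reduces to
    [1 - u^(p-1) <= (p-1) (1-u)], which is Bernoulli. *)
Lemma sgnpow_lipschitz p a b : 2 <= p ->
  (sgnpow p a - sgnpow p b) * (a - b) <=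
  (p - 1) * ((`|a| `^ (p - 2) + `|b| `^ (p - 2)) * (a - b) ^+ 2).
Proof.
move=> p2; have [p1 p1'] : 0 < p - 1 /\ 1 <= p - 1 by split; lra.
wlog : a b / `|b| <= `|a|.
  move=> W; case: (leP `|b| `|a|) => [/W //|/ltW /W].
  by congr (_ <= _); ring.
move=> ba.
have [A0 B0] := (powR_ge0 `|a| (p - 2), powR_ge0 `|b| (p - 2)).
have [ab|ab] := leP (a * b) 0.
  rewrite /sgnpow.
  set A := `|a| `^ _ in A0 *; set B := `|b| `^ _ in B0 *.
  apply: (@le_trans _ _ ((A + B) * (a - b) ^+ 2)); last first.
    apply: ler_peMl; last by [].
    by rewrite mulr_ge0 ?addr_ge0 ?sqr_ge0.
  rewrite -subr_ge0.
  have -> : (A + B) * (a - b) ^+ 2 - (a * A - b * B) * (a - b) =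
     a ^+ 2 * B + b ^+ 2 * A + (A + B) * - (a * b) by ring.
  have nab : 0 <= - (a * b) by rewrite oppr_ge0.
  by apply: addr_ge0; [apply: addr_ge0|]; apply: mulr_ge0; rewrite ?sqr_ge0 ?addr_ge0.
have a0 : a != 0 by apply: contraTneq ab => ->; rewrite mul0r ltxx.
set u := b / a.
have hb : b = a * u by rewrite /u; field.
have u0 : 0 <= u.
  rewrite /u (_ : b / a = a * b / a ^+ 2); last by field.
  by rewrite divr_ge0 ?sqr_ge0 // ltW.
have u1 : u <= 1.
  by rewrite -(ger0_norm u0) /u normrM normfV ler_pdivrMr ?normr_gt0 // mul1r.
have -> : sgnpow p b = sgnpow p a * u `^ (p - 1).
  rewrite /sgnpow hb normrM (ger0_norm u0) powRM // -(@mulr_powRB1 _ u (p - 1)) //.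
  by rewrite (_ : p - 1 - 1 = p - 2); ring.
have h : 1 + (p - 1) * (u - 1) <= u `^ (p - 1) by apply: bernoulli_powR.
apply: (@le_trans _ _ ((p - 1) * (`|a| `^ (p - 2) * (a - b) ^+ 2))); last first.
  rewrite ler_wpM2l ?(ltW p1) //.
  by rewrite ler_wpM2r ?sqr_ge0 // lerDl.
rewrite hb /sgnpow; set A := `|a| `^ _ in A0 *; set v := u `^ _ in h *.
have -> : (a * A - a * A * v) * (a - a * u) = (a ^+ 2 * A * (1 - u)) * (1 - v) by ring.
have -> : (p - 1) * (A * (a - a * u) ^+ 2) =
   (a ^+ 2 * A * (1 - u)) * ((p - 1) * (1 - u)) by ring.
apply: ler_wpM2l; first by rewrite (mulr_ge0 (mulr_ge0 (sqr_ge0 _) A0)) ?subr_ge0.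
lra.
Qed.

(** After scaling by [z] and [D] this is Young's inequality with exponents [p / (p - 2)] and
    [p / 2]: the termwise form of Hoelder. *)
Lemma young_powR p a y z D : 2 <= p -> 0 < z -> 0 < D -> 0 <= a -> 0 <= y ->
  a `^ (p - 2) * y ^+ 2 <=
  z `^ (p - 2) * D ^+ 2 *
    ((p - 2) / p * (a `^ p / z `^ p) + 2 / p * (y `^ p / D `^ p)).
Proof.
move=> p2 z0 D0 a0 y0.
have [zn Dn] : z != 0 /\ D != 0 by rewrite !gt_eqF.
have p0 : 0 < p by lra.
have pn : p != 0 by rewrite gt_eqF.
have E : a `^ (p - 2) * y ^+ 2 =
   z `^ (p - 2) * D ^+ 2 * ((a / z) `^ (p - 2) * ((y / D) `^ 2%:R)).
  rewrite {1}(_ : a = z * (a / z)); last by field.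
  rewrite powRM ?divr_ge0 // ?(ltW z0) // powR_mulrn ?divr_ge0 ?(ltW D0) //.
  by field.
rewrite E; apply: ler_wpM2l; first by rewrite mulr_ge0 ?powR_ge0 ?sqr_ge0.
have qd x t : 0 <= x -> 0 < t -> x `^ p / t `^ p = (x / t) `^ p.
  move=> x0 t0; rewrite powRM ?invr_ge0 ?(ltW t0) //.
  by rewrite -[t^-1]powR_inv1 ?(ltW t0) // -powRrM mulN1r powRN.
rewrite !qd //; have az : 0 <= a / z by rewrite divr_ge0 // ltW.
have yD : 0 <= y / D by rewrite divr_ge0 // ltW.
(* At [p = 2] the exponent [p / (p - 2)] degenerates, but both sides agree. *)
move: p2; rewrite le_eqVlt => /predU1P[<-|p2].
  by rewrite subrr powRr0 !mul0r mul1r add0r divff ?mul1r // pnatr_eq0.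
have pm : 0 < p - 2 by lra.
have := @conjugate_powR _ ((a / z) `^ (p - 2)) ((y / D) `^ 2) (p / (p - 2)) (p / 2)
  (powR_ge0 _ _) (powR_ge0 _ _).
rewrite !divr_gt0 // => /(_ erefl erefl).
have -> : (p / (p - 2))^-1 + (p / 2)^-1 = 1 by field; rewrite pn gt_eqF.
move=> /(_ erefl) /le_trans; apply.
rewrite -!powRrM.
have -> : (p - 2) * (p / (p - 2)) = p by field; rewrite gt_eqF.
have -> : 2 * (p / 2) = p by field.
by rewrite !invf_div [leLHS]addrC addrC mulrC [X in _ + X]mulrC.
Qed.

End ScalarInequalities.

(** * Functional calculus of Hermitian matrices and trace formulas *)

Lemma mxtrace_conj (F : comNzRingType) n (U D V H : 'M[F]_n) :
  \tr (U *m D *m V *m H) = \tr (D *m (V *m H *m U)).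
Proof. by rewrite -!mulmxA mxtrace_mulC -!mulmxA. Qed.

Section FunctionalCalculus.
Variable (R : realType).
Local Notation C := R[i].
Local Notation rc := (real_complex R).
Local Notation Re := (@complex.Re R).

Definition normc2 (z : C) : R := Re z ^+ 2 + complex.Im z ^+ 2.

Lemma normc2_ge0 z : 0 <= normc2 z.
Proof. by rewrite addr_ge0 // sqr_ge0. Qed.

Lemma mulc_conj (z : C) : z * conjc z = rc (normc2 z).
Proof.
by case: z => a b; rewrite /normc2; apply/eqP; rewrite eq_complex /=; apply/andP; split; apply/eqP; ring.
Qed.

Lemma normc2_conj z : normc2 (conjc z) = normc2 z.
Proof. by case: z => a b; rewrite /normc2 /= sqrrN. Qed.

Lemma ReD x y : Re (x + y) = Re x + Re y.
Proof. by case: x; case: y. Qed.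

Lemma ReN x : Re (- x) = - Re x.
Proof. by case: x. Qed.

Lemma ReM_rc (r : R) x : Re (rc r * x) = r * Re x.
Proof. by case: x => a b /=; rewrite mul0r subr0. Qed.

Variable n : nat.
Implicit Types (A B : 'M[C]_n) (g h : R -> R).

Lemma adjmxE A i j : adjmx A i j = conjc (A j i).
Proof. by rewrite !mxE. Qed.

Lemma adjmxK A : adjmx (adjmx A) = A.
Proof. by apply/matrixP => i j; rewrite !adjmxE conjcK. Qed.

Lemma adjmxM A B : adjmx (A *m B) = adjmx B *m adjmx A.
Proof. by rewrite /adjmx map_mxM trmx_mul. Qed.

Lemma adjmx_mul3 A B D : adjmx (A *m B *m D) = adjmx D *m (adjmx B *m adjmx A).
Proof. by rewrite !adjmxM. Qed.

Lemma adjmxD A B : adjmx (A + B) = adjmx A + adjmx B.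
Proof. by rewrite /adjmx map_mxD linearD. Qed.

Lemma adjmxN A : adjmx (- A) = - adjmx A.
Proof. by rewrite /adjmx map_mxN linearN. Qed.

Lemma adjmxZ (r : R) A : adjmx (rc r *: A) = rc r *: adjmx A.
Proof. by apply/matrixP => i j; rewrite !mxE rmorphM; congr (_ * _); exact: conjc_real. Qed.

Definition herm A := adjmx A = A.

Lemma hermD A B : herm A -> herm B -> herm (A + B).
Proof. by rewrite /herm adjmxD => -> ->. Qed.

Lemma hermB A B : herm A -> herm B -> herm (A - B).
Proof. by rewrite /herm adjmxD adjmxN => -> ->. Qed.

Lemma hermZ (r : R) A : herm A -> herm (rc r *: A).
Proof. by rewrite /herm adjmxZ => ->. Qed.

Lemma herm_sqr A : herm A -> herm (A *m A).
Proof. by rewrite /herm adjmxM => ->. Qed.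

(** For Hermitian [A] the spectral diagonal is real, so taking the real part loses nothing. *)
Definition eigval A (i : 'I_n) : R := Re (spectral_diag A 0 i).

Definition rdiag (f : 'I_n -> R) : 'M[C]_n := diag_mx (\row_i rc (f i)).

Definition fcalc g A : 'M[C]_n :=
  adjmx (spectralmx A) *m rdiag (fun i => g (eigval A i)) *m spectralmx A.

Lemma adj_spectral A : adjmx (spectralmx A) = (map_mx (@Num.conj C) (spectralmx A)^T).
Proof. by rewrite /adjmx map_trmx. Qed.

Lemma spectral_mul_adj A : spectralmx A *m adjmx (spectralmx A) = 1%:M.
Proof. by rewrite adj_spectral; apply/unitarymxP/spectral_unitarymx. Qed.

Lemma adj_mul_spectral A : adjmx (spectralmx A) *m spectralmx A = 1%:M.
Proof. exact/mulmx1C/spectral_mul_adj. Qed.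

Lemma fcalc_id A : herm A -> fcalc id A = A.
Proof.
move=> hA.
have hs : A \is hermsymmx.
  by apply/is_hermitianmxP; rewrite expr0 scale1r -map_trmx; symmetry.
have /orthomx_spectralP := hermitian_normalmx hs.
rewrite (invmx_unitary (spectral_unitarymx A)) -adj_spectral => E; rewrite [RHS]E.
rewrite /fcalc.
rewrite /rdiag.
congr (_ *m _).
congr (_ *m _).
congr diag_mx.
apply/rowP => i; rewrite mxE /eigval.
by apply: RRe_real; move/mxOverP: (hermitian_spectral_diag_real hs) => /(_ 0 i).
Qed.

Lemma rdiagM f1 f2 : rdiag f1 *m rdiag f2 = rdiag (fun i => f1 i * f2 i).
Proof.
rewrite /rdiag mulmx_diag; congr diag_mx; apply/rowP => i.
by rewrite !mxE -rmorphM.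
Qed.

Lemma fcalcM g h A : fcalc g A *m fcalc h A = fcalc (fun x => g x * h x) A.
Proof.
rewrite /fcalc !mulmxA -(mulmxA (_ *m rdiag _) (spectralmx A)).
by rewrite spectral_mul_adj mulmx1 -(mulmxA (adjmx _)) rdiagM.
Qed.

Lemma fcalc1 A : fcalc (fun=> 1) A = 1%:M.
Proof.
rewrite /fcalc /rdiag.
have -> : \row_(i < n) rc 1 = const_mx 1 by apply/rowP => i; rewrite !mxE.
by rewrite diag_const_mx mulmx1 adj_mul_spectral.
Qed.

Lemma adj_rdiag f : adjmx (rdiag f) = rdiag f.
Proof.
apply/matrixP => i j; rewrite adjmxE !mxE eq_sym; case: eqP => [->|_].
  by rewrite mulr1n conjc_real.
by rewrite mulr0n conjc0.
Qed.

Lemma fcalc_herm g A : herm (fcalc g A).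
Proof. by rewrite /herm /fcalc !adjmxM adjmxK adj_rdiag mulmxA. Qed.

(** The overlaps [|<u_i, v_j>|^2] of the two eigenbases. They are squared moduli of the entries of a
    unitary matrix, hence doubly stochastic. *)
Definition wt A B (i j : 'I_n) : R :=
  normc2 ((spectralmx A *m adjmx (spectralmx B)) i j).

Lemma wt_ge0 A B i j : 0 <= wt A B i j.
Proof. exact: normc2_ge0. Qed.

Lemma wtC A B i j : wt A B i j = wt B A j i.
Proof.
rewrite /wt -normc2_conj -adjmxE adjmxM adjmxK //.
Qed.

Lemma conj_rdiag_diag (M : 'M[C]_n) f i :
  (M *m rdiag f *m adjmx M) i i = rc (\sum_j f j * normc2 (M i j)).
Proof.
rewrite /rdiag mul_mx_diag !mxE rmorph_sum; apply: eq_bigr => j _.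
by rewrite !mxE mulrAC mulc_conj -rmorphM mulrC.
Qed.

Lemma fcalc_diag A h B i :
  (spectralmx A *m fcalc h B *m adjmx (spectralmx A)) i i =
  rc (\sum_j h (eigval B j) * wt A B i j).
Proof.
rewrite /wt -conj_rdiag_diag /fcalc adjmxM adjmxK.
by rewrite !mulmxA.
Qed.

Lemma wt_sumr A B i : \sum_j wt A B i j = 1.
Proof.
have := fcalc_diag A (fun=> 1) B i.
rewrite fcalc1 mulmx1 spectral_mul_adj mxE eqxx => /(congr1 Re) /= ->.
by apply: eq_bigr => j _; rewrite mul1r.
Qed.

Lemma wt_suml A B j : \sum_i wt A B i j = 1.
Proof. by under eq_bigr do rewrite wtC; exact: wt_sumr. Qed.

Definition retr A : R := Re (\tr A).

Lemma retrD A B : retr (A + B) = retr A + retr B.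
Proof. by rewrite /retr linearD ReD. Qed.

Lemma retrN A : retr (- A) = - retr A.
Proof. by rewrite /retr linearN ReN. Qed.

Lemma retrB A B : retr (A - B) = retr A - retr B.
Proof. by rewrite retrD retrN. Qed.

Lemma retr_mulBB A1 A2 B1 B2 : retr ((A1 - A2) *m (B1 - B2)) =
  retr (A1 *m B1) - retr (A1 *m B2) - (retr (A2 *m B1) - retr (A2 *m B2)).
Proof. by rewrite mulmxBl !mulmxBr !retrB. Qed.

Lemma retrZ (r : R) A : retr (rc r *: A) = r * retr A.
Proof. by rewrite /retr linearZ ReM_rc. Qed.

Lemma retr_mulC A B : retr (A *m B) = retr (B *m A).
Proof. by rewrite /retr mxtrace_mulC. Qed.

Lemma retr_sum I (r : seq I) (P : pred I) (F : I -> 'M[C]_n) :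
  retr (\sum_(i <- r | P i) F i) = \sum_(i <- r | P i) retr (F i).
Proof.
apply: (big_morph retr); first exact: retrD.
by rewrite /retr linear0.
Qed.

(** Cyclicity moves the eigenbasis of [A] onto [h(B)]; against a diagonal matrix the trace sees only
    the diagonal, computed in [fcalc_diag]. *)
Lemma retr_fcalc2 g A h B :
  retr (fcalc g A *m fcalc h B) =
  \sum_i \sum_j g (eigval A i) * h (eigval B j) * wt A B i j.
Proof.
have E : \tr (fcalc g A *m fcalc h B) =
    \tr (rdiag (fun i => g (eigval A i)) *m
         (spectralmx A *m fcalc h B *m adjmx (spectralmx A))).
  move: (fcalc h B) => H.
  exact: mxtrace_conj.
rewrite /retr E; apply: (congr1 Re (y := rc _)).
rewrite /mxtrace rmorph_sum; apply: eq_bigr => i _.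
rewrite /rdiag mul_diag_mx mxE mxE fcalc_diag -rmorphM mulr_sumr.
by congr (rc _); apply: eq_bigr => j _; rewrite mulrA.
Qed.



Lemma spectral_fcalc g A :
  spectralmx A *m fcalc g A *m adjmx (spectralmx A) = rdiag (fun i => g (eigval A i)).
Proof.
by rewrite /fcalc !mulmxA spectral_mul_adj mul1mx -mulmxA spectral_mul_adj mulmx1.
Qed.

Lemma retr_fcalc g A : retr (fcalc g A) = \sum_i g (eigval A i).
Proof.
rewrite -[fcalc g A]mulmx1 -(fcalc1 A) retr_fcalc2; apply: eq_bigr => i _.
by under eq_bigr do rewrite mulr1; rewrite -mulr_sumr wt_sumr mulr1.
Qed.

(** With [sum_wtr], this spreads a single sum over the weights, so that it can be compared termwise
    with a mixed trace. *)
Lemma sum_wtl A B (G : 'I_n -> R) : \sum_i G i = \sum_i \sum_j G i * wt A B i j.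
Proof. by apply: eq_bigr => i _; rewrite -mulr_sumr wt_sumr mulr1. Qed.

Lemma sum_wtr A B (G : 'I_n -> R) : \sum_j G j = \sum_i \sum_j G j * wt A B i j.
Proof.
rewrite exchange_big; apply: eq_bigr => j _.
by rewrite -mulr_sumr wt_suml mulr1.
Qed.

Lemma eq_fcalc g h A : g =1 h -> fcalc g A = fcalc h A.
Proof. by move=> gh; congr fcalc; apply/funext. Qed.

Lemma fcalc_mulr g A : herm A -> fcalc g A *m A = fcalc (fun x => g x * x) A.
Proof. by move=> hA; rewrite -fcalcM fcalc_id. Qed.

Lemma fcalc_mull g A : herm A -> A *m fcalc g A = fcalc (fun x => g x * x) A.
Proof.
move=> hA; rewrite -[X in X *m _](fcalc_id hA) fcalcM.
by apply: eq_fcalc => x; rewrite mulrC.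
Qed.

Lemma retr_fcalc_mul g A B : herm B ->
  retr (fcalc g A *m B) = \sum_i \sum_j g (eigval A i) * eigval B j * wt A B i j.
Proof. by move=> hB; rewrite -{1}(fcalc_id hB) retr_fcalc2. Qed.

Lemma fcalc_sqr A : herm A -> A *m A = fcalc (fun x => x ^+ 2) A.
Proof. by move=> hA; rewrite -{1 2}(fcalc_id hA) fcalcM. Qed.

End FunctionalCalculus.


(** * Convexity and smoothness of [tr |A|^p] *)

Section TraceInequalities.
Variables (R : realType) (n : nat).
Implicit Types (A B X Y : 'M[R[i]]_n) (p q z D : R).

Definition trpow p A : R := \sum_i `|eigval A i| `^ p.

Lemma trpow_ge0 p A : 0 <= trpow p A.
Proof. by apply: sumr_ge0 => i _; exact: powR_ge0. Qed.

(** Convexity, with gradient [p * sgnpow p] at [A]: once all traces are weighted sums over pairs of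
    eigenvalues, this is [powR_norm_tangent] for each pair. *)
Lemma trpow_gradient p A B : 1 <= p -> herm A -> herm B ->
  trpow p A + p * retr (fcalc (sgnpow p) A *m (B - A)) <= trpow p B.
Proof.
move=> p1 hA hB.
rewrite mulmxBr retrB fcalc_mulr // retr_fcalc_mul // retr_fcalc /trpow (sum_wtl A B (fun i => _ `^ p)).
rewrite (sum_wtl A B (fun i => sgnpow p _ * _)) (sum_wtr A B (fun i => _ `^ p)).
rewrite -sumrB mulr_sumr -big_split; apply: ler_sum => i _ /=.
rewrite -sumrB mulr_sumr -big_split; apply: ler_sum => j _ /=.
rewrite -mulrBl mulrA -mulrDl -mulrBr ler_wpM2r ?wt_ge0 //.
exact: powR_norm_tangent.
Qed.

(** The gradient inequality at the mean [M] towards each [X j], averaged; the linear terms [G j]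
    cancel. *)
Lemma trpow_jensen p m (w : 'I_m -> R) (X : 'I_m -> 'M[R[i]]_n) : 1 <= p ->
  (forall j, herm (X j)) -> (forall j, 0 <= w j) -> \sum_j w j = 1 ->
  trpow p (\sum_j real_complex R (w j) *: X j) <= \sum_j w j * trpow p (X j).
Proof.
move=> p1 hX w0 w1; set M := \sum_j _ *: _.
have hM : herm M.
  rewrite /M; elim/big_ind: _ => [|A B hA hB|j _]; last exact: hermZ.
  - by apply/matrixP => i j; rewrite !mxE conjc0.
  - exact: hermD.
pose G j := retr (fcalc (sgnpow p) M *m (X j - M)).
have G0 : \sum_j w j * G j = 0.
  transitivity (retr (fcalc (sgnpow p) M *m \sum_j real_complex R (w j) *: (X j - M))).
    by rewrite mulmx_sumr retr_sum; apply: eq_bigr => j _; rewrite -scalemxAr retrZ.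
  under eq_bigr do rewrite scalerBr.
  by rewrite sumrB -scaler_suml -rmorph_sum w1 rmorph1 scale1r subrr mulmx0 /retr mxtrace0.
apply: (@le_trans _ _ (\sum_j w j * (trpow p M + p * G j))); last first.
  by apply: ler_sum => j _; rewrite ler_wpM2l // trpow_gradient.
under eq_bigr do rewrite mulrDr mulrCA.
by rewrite big_split /= -mulr_suml w1 mul1r -mulr_sumr G0 mulr0 addr0.
Qed.

(** The chosen eigenbases of [A] and [B = c A] may be unrelated. However, the sum of
    [wt * (c a_i - b_j)^2] is the squared Hilbert-Schmidt norm of [c A - B], hence zero, so
    [b_j = c a_i] wherever the weight is nonzero. *)
Lemma trpowZ p c A : herm A -> trpow p (real_complex R c *: A) = `|c| `^ p * trpow p A.
Proof.
move=> hA; set B := _ *: A; have hB : herm B by exact: hermZ.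
have W0 i j : wt A B i j * (c * eigval A i - eigval B j) ^+ 2 = 0.
  have : \sum_i \sum_j wt A B i j * (c * eigval A i - eigval B j) ^+ 2 = 0.
    have E : retr (B *m B) = c ^+ 2 * retr (A *m A).
      by rewrite /B -scalemxAl -scalemxAr scalerA -rmorphM retrZ.
    have E' : retr (A *m B) = c * retr (A *m A).
      by rewrite /B -scalemxAr retrZ.
    transitivity (c ^+ 2 * retr (A *m A) - c * retr (A *m B) *+ 2 + retr (B *m B)).
      rewrite (fcalc_sqr hA) (fcalc_sqr hB) -[X in X *m B](fcalc_id hA).
      rewrite retr_fcalc_mul // !retr_fcalc (sum_wtl A B (fun i => eigval A i ^+ 2)).
      rewrite (sum_wtr A B (fun i => eigval B i ^+ 2)) -mulrnAr -sumrMnl !mulr_sumr.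
      rewrite -sumrB -big_split; apply: eq_bigr => k _ /=.
      rewrite -sumrMnl !mulr_sumr -sumrB -big_split; apply: eq_bigr => l _ /=.
      by ring.
    by rewrite E E'; ring.
  move/eqP; rewrite psumr_eq0 => [/allP /(_ i (mem_index_enum _))|k _]; last first.
    by apply: sumr_ge0 => l _; rewrite mulr_ge0 ?wt_ge0 ?sqr_ge0.
  rewrite /= psumr_eq0 => [/allP /(_ j (mem_index_enum _)) /eqP //|l _].
  by rewrite mulr_ge0 ?wt_ge0 ?sqr_ge0.
rewrite /trpow mulr_sumr (sum_wtr A B) (sum_wtl A B (fun i => _ * _)).
apply: eq_bigr => i _; apply: eq_bigr => j _.
have /eqP := W0 i j; rewrite mulf_eq0 sqrf_eq0 => /orP[/eqP ->|].
  by rewrite !mulr0.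
by rewrite subr_eq0 => /eqP <-; rewrite normrM powRM.
Qed.

Lemma retr_fcalc_sqr g A B : herm A -> herm B ->
  retr (fcalc g A *m ((A - B) *m (A - B))) =
  \sum_i \sum_j g (eigval A i) * (eigval A i - eigval B j) ^+ 2 * wt A B i j.
Proof.
move=> hA hB.
have -> : fcalc g A *m ((A - B) *m (A - B)) =
   fcalc g A *m (A *m A) - (fcalc g A *m A) *m B - (fcalc g A *m B) *m A
   + fcalc g A *m (B *m B).
  by rewrite mulmxBl !mulmxBr !mulmxA opprB addrA addrAC -!addrA.
(* Cyclicity brings the trailing [A] next to [g(A)], leaving only traces of one function of [A]
   times one function of [B]. *)
rewrite retrD !retrB (retr_mulC (fcalc g A *m B)) (mulmxA A (fcalc g A)).
rewrite (fcalc_sqr hA) (fcalc_sqr hB).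
rewrite (fcalc_mulr g hA) (fcalc_mull g hA) fcalcM !(retr_fcalc_mul _ _ hB) retr_fcalc2 retr_fcalc.
rewrite (sum_wtl A B) -!sumrB -big_split; apply: eq_bigr => i _ /=.
rewrite -!sumrB -big_split; apply: eq_bigr => j _ /=.
by ring.
Qed.

Lemma trpow_lipschitz p A B : 2 <= p -> herm A -> herm B ->
  retr ((fcalc (sgnpow p) A - fcalc (sgnpow p) B) *m (A - B)) <=
  (p - 1) * (retr (fcalc (fun x => `|x| `^ (p - 2)) A *m ((A - B) *m (A - B))) +
             retr (fcalc (fun x => `|x| `^ (p - 2)) B *m ((A - B) *m (A - B)))).
Proof.
move=> p2 hA hB; set f := sgnpow p.
have -> : retr ((fcalc f A - fcalc f B) *m (A - B)) =
   \sum_i \sum_j (f (eigval A i) - f (eigval B j)) *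
     (eigval A i - eigval B j) * wt A B i j.
  rewrite retr_mulBB (retr_mulC (fcalc f B) A).
  have -> : retr (A *m fcalc f B) = \sum_i \sum_j eigval A i * f (eigval B j) * wt A B i j.
    by rewrite -{1}(fcalc_id hA) retr_fcalc2.
  rewrite !fcalc_mulr // retr_fcalc_mul // !retr_fcalc.
  rewrite (sum_wtl A B) (sum_wtr A B (fun i => _ * eigval B i)).
  rewrite -!sumrB; apply: eq_bigr => i _.
  rewrite -!sumrB; apply: eq_bigr => j _.
  by ring.
rewrite retr_fcalc_sqr //.
(* The term with the function of [B] is expanded with [B] as first basis; swapping the sums then
   aligns the weights. *)
have -> : (A - B) *m (A - B) = (B - A) *m (B - A).
  by rewrite -(opprB B A) mulmxN mulNmx opprK.
rewrite retr_fcalc_sqr // [X in _ <= _ * (_ + X)]exchange_big -big_split mulr_sumr /=.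
apply: ler_sum => i _; rewrite -big_split mulr_sumr /=.
apply: ler_sum => j _; rewrite (wtC B A j i).
rewrite -mulrDl mulrA ler_wpM2r ?wt_ge0 //.
rewrite -(sqrrN (eigval B j - _)) opprB -mulrDl.
exact: sgnpow_lipschitz.
Qed.

(** [young_powR] summed over the weights; its coefficients [(p - 2) / p] and [2 / p] add up to 1. *)
Lemma retr_holder p A Y z D : 2 <= p -> herm A -> herm Y -> 0 < z -> 0 < D ->
  trpow p A <= z `^ p -> trpow p Y <= D `^ p ->
  retr (fcalc (fun x => `|x| `^ (p - 2)) A *m (Y *m Y)) <= z `^ (p - 2) * D ^+ 2.
Proof.
move=> p2 hA hY z0 D0 FA FY; have p0 : 0 < p by lra.
rewrite (fcalc_sqr hY) retr_fcalc2.
set K := z `^ (p - 2) * D ^+ 2.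
have K0 : 0 <= K by rewrite mulr_ge0 ?powR_ge0 ?sqr_ge0.
apply: (@le_trans _ _ (K * ((p - 2) / p * (trpow p A / z `^ p) +
                            2 / p * (trpow p Y / D `^ p)))).
  rewrite /trpow (sum_wtl A Y (fun i => _ `^ p)) (sum_wtr A Y (fun i => _ `^ p)).
  rewrite !mulr_suml !mulr_sumr -big_split mulr_sumr /=; apply: ler_sum => i _.
  rewrite !mulr_suml !mulr_sumr -big_split mulr_sumr /=; apply: ler_sum => j _.
  have := young_powR p2 z0 D0 (normr_ge0 (eigval A i)) (normr_ge0 (eigval Y j)).
  rewrite real_normK ?num_real // => /(ler_wpM2r (wt_ge0 A Y i j)) /le_trans; apply.
  by rewrite /K le_eqVlt; apply/orP; left; apply/eqP; ring.
rewrite -[leRHS]mulr1 ler_wpM2l //.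
have zA : trpow p A / z `^ p <= 1 by rewrite ler_pdivrMr ?powR_gt0 // mul1r.
have DY : trpow p Y / D `^ p <= 1 by rewrite ler_pdivrMr ?powR_gt0 // mul1r.
rewrite [leRHS](_ : 1 = (p - 2) / p * 1 + 2 / p * 1); last first.
  by field; rewrite gt_eqF.
by apply: lerD; apply: ler_wpM2l => //; rewrite divr_ge0 ?(ltW p0) // subr_ge0.
Qed.

(** Convexity is used at the far end [B + Y]: the increase is at most [p] times the trace of
    [sgnpow(B + Y) Y]. Subtracting the nonpositive trace of [sgnpow(B) Y] makes [trpow_lipschitz]
    applicable. The factor 2 counts its two Hoelder terms. *)
Lemma trpow_smooth p B Y z D : 2 <= p -> herm B -> herm Y -> 0 < z -> 0 < D ->
  trpow p B <= z `^ p -> trpow p (B + Y) <= z `^ p -> trpow p Y <= D `^ p ->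
  retr (fcalc (sgnpow p) B *m Y) <= 0 ->
  trpow p (B + Y) <= trpow p B + 2 * p * (p - 1) * (z `^ (p - 2) * D ^+ 2).
Proof.
move=> p2 hB hY z0 D0 FB FBY FY neg.
have arith (K T T' a b u v : R) : T - T' <= (p - 1) * (a + b) ->
    v + p * - T <= u -> a <= K -> b <= K -> T' <= 0 ->
    v <= u + 2 * p * (p - 1) * K.
  move=> h1 h2 h3 h4 h5.
  have h6 : (p - 1) * (a + b) <= (p - 1) * (K + K) by apply: ler_wpM2l; lra.
  have h7 : T <= (p - 1) * (K + K) by lra.
  have : p * T <= p * ((p - 1) * (K + K)) by apply: ler_wpM2l => //; lra.
  lra.
have hBY := hermD hB hY; have p1 : 1 <= p by lra.
have YE : B + Y - B = Y by rewrite addrC addKr.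
have := trpow_gradient p1 hBY hB.
have := trpow_lipschitz p2 hBY hB.
rewrite YE (_ : B - (B + Y) = - Y); last by rewrite opprD addNKr.
rewrite mulmxN retrN mulmxBl retrB => h1 h2.
have h3 := retr_holder p2 hBY hY z0 D0 FBY FY.
have h4 := retr_holder p2 hB hY z0 D0 FB FY.
apply: arith h1 h2 h3 h4 neg.
Qed.

End TraceInequalities.

(** * The Clarkson-McCarthy inequality through Rotfel'd's inequality *)

Lemma conj_mulmx (F : comNzRingType) n (U V A B : 'M[F]_n) : V *m U = 1%:M ->
  U *m A *m V *m (U *m B *m V) = U *m (A *m B) *m V.
Proof. by move=> VU; rewrite -!mulmxA (mulmxA V U) VU mul1mx. Qed.

Lemma mulmx_reassoc (F : comNzRingType) n (U W V' D U' V : 'M[F]_n) :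
  U *m (W *m (V' *m D *m U') *m W) *m V = U *m W *m V' *m D *m (U' *m (W *m V)).
Proof. by rewrite !mulmxA. Qed.

Lemma sandwichD (F : comNzRingType) n (W A B : 'M[F]_n) :
  W *m (A + B) *m W = W *m A *m W + W *m B *m W.
Proof. by rewrite mulmxDr mulmxDl. Qed.

Lemma mulmx_parallelogram (F : comNzRingType) n (A B : 'M[F]_n) :
  (A + B) *m (A + B) + (A - B) *m (A - B) =
  (A *m A + B *m B) + (A *m A + B *m B).
Proof.
have -> : (A + B) *m (A + B) = (A *m A + B *m B) + (A *m B + B *m A).
  by rewrite mulmxDl !mulmxDr [X in _ + X]addrC addrACA.
have -> : (A - B) *m (A - B) = (A *m A + B *m B) - (A *m B + B *m A).
  by rewrite mulmxBl !mulmxBr opprB addrACA opprD.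
by rewrite addrACA subrr addr0.
Qed.

Section ClarksonMcCarthy.
Variables (R : realType) (n : nat).
Implicit Types (A B X Y K E : 'M[R[i]]_n) (p q : R).
Local Notation rc := (real_complex R).

Let in_basis K A : 'M[R[i]]_n := spectralmx K *m A *m adjmx (spectralmx K).

Let in_basisD K A B : in_basis K (A + B) = in_basis K A + in_basis K B.
Proof. by rewrite /in_basis mulmxDr mulmxDl. Qed.

Let in_basisM K A B : in_basis K (A *m B) = in_basis K A *m in_basis K B.
Proof.
exact/esym/conj_mulmx/adj_mul_spectral.
Qed.

Let in_basis_id K : herm K -> in_basis K K = rdiag (eigval K).
Proof. by move=> hK; rewrite -{2}(fcalc_id hK) /in_basis spectral_fcalc. Qed.

Let sqr_diag K E i : herm E ->
  in_basis K (E *m E) i i = rc (\sum_j eigval E j ^+ 2 * wt K E i j).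
Proof. by move=> hE; rewrite (fcalc_sqr hE) /in_basis fcalc_diag. Qed.

(** Both sides are the [i]-th diagonal entry of [K] in its own eigenbasis. *)
Lemma eigval_sum_sqr X Y i : herm X -> herm Y ->
  let K := X *m X + Y *m Y in
  eigval K i = \sum_j eigval X j ^+ 2 * wt K X i j +
               \sum_j eigval Y j ^+ 2 * wt K Y i j.
Proof.
move=> hX hY K.
have hK : herm K by apply: hermD; exact: herm_sqr.
have /matrixP /(_ i i) := in_basis_id hK.
rewrite {2}/K in_basisD [LHS]mxE (sqr_diag _ i hX) (sqr_diag _ i hY) -rmorphD [RHS]mxE eqxx mulr1n mxE.
by move=> /complexI <-.
Qed.

Lemma eigval_sum_sqr_ge0 X Y i : herm X -> herm Y ->
  0 <= eigval (X *m X + Y *m Y) i.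
Proof.
move=> hX hY; rewrite eigval_sum_sqr // addr_ge0 //;
  by apply: sumr_ge0 => j _; rewrite mulr_ge0 ?sqr_ge0 ?wt_ge0.
Qed.

(* [t = <v, K^-1 v>] for the eigenvector [v] of [X] with eigenvalue [x]. As
   [K >= X^2 >= x^2 v v^*], one has [t = <K^-1 v, K (K^-1 v)> >= x^2 t^2].
   Here [K^-1] is the pseudo-inverse, because [0^-1 = 0]. *)
Lemma sqr_eigval_inv_le1 X Y j : herm X -> herm Y ->
  eigval X j ^+ 2 * (\sum_i (eigval (X *m X + Y *m Y) i)^-1 *
                            wt (X *m X + Y *m Y) X i j) <= 1.
Proof.
move=> hX hY; set K := X *m X + Y *m Y; set t := \sum_i _; set x2 := _ ^+ 2.
have hK : herm K by apply: hermD; exact: herm_sqr.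
pose W := fcalc GRing.inv K.
have hW : herm W by exact: fcalc_herm.
have WKW : W *m K *m W = W.
  rewrite -{1}(fcalc_id hK) !fcalcM; apply: eq_fcalc => x.
  have [->|x0] := eqVneq x 0; first by rewrite invr0 mulr0.
  by rewrite mulVf // mul1r.
have tE : in_basis X W j j = rc t.
  rewrite /in_basis fcalc_diag; congr (rc _).
  by apply: eq_bigr => i _; rewrite wtC.
clearbody W.
have conjW (E : 'M[R[i]]_n) : herm E ->
   (in_basis X (W *m (E *m E) *m W)) j j =
   rc (\sum_l eigval E l ^+ 2 *
         normc2 ((spectralmx X *m W *m adjmx (spectralmx E)) j l)).
  move=> hE; rewrite -(conj_rdiag_diag _ (fun l => eigval E l ^+ 2)).
  by rewrite adjmx_mul3 adjmxK hW (fcalc_sqr hE) /in_basis /fcalc mulmx_reassoc.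
have tge : x2 * t ^+ 2 <= t.
  have : rc t = rc (\sum_l eigval X l ^+ 2 *
         normc2 ((spectralmx X *m W *m adjmx (spectralmx X)) j l) +
       \sum_l eigval Y l ^+ 2 *
         normc2 ((spectralmx X *m W *m adjmx (spectralmx Y)) j l)).
    rewrite -tE.
    rewrite -[in LHS]WKW.
    rewrite (sandwichD W (X *m X) (Y *m Y)).
    rewrite in_basisD.
    rewrite [LHS]mxE.
    by rewrite rmorphD; congr (_ + _); [exact: conjW hX|exact: conjW hY].
  move=> /complexI {2}->.
  apply: (@le_trans _ _ (\sum_l eigval X l ^+ 2 *
         normc2 ((spectralmx X *m W *m adjmx (spectralmx X)) j l))); last first.
    by rewrite lerDl sumr_ge0 // => l _; rewrite mulr_ge0 ?sqr_ge0 ?normc2_ge0.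
  (* The term [l = j] alone equals [x2 * t ^+ 2]; the others are nonnegative. *)
  rewrite (bigD1 j) //= -/(in_basis X W) tE /normc2 /= expr0n addr0 lerDl.
  by rewrite sumr_ge0 // => l _; rewrite mulr_ge0 ?sqr_ge0 ?normc2_ge0.
have t0 : 0 <= t.
  apply: sumr_ge0 => i _.
  by rewrite mulr_ge0 ?wt_ge0 // invr_ge0 eigval_sum_sqr_ge0.
move: t0; rewrite le_eqVlt => /predU1P[<-|t0]; first by rewrite mulr0.
by rewrite -(ler_pM2r t0) mul1r -mulrA -expr2.
Qed.

(** For the eigenvector [v] of [X] with eigenvalue [x], Jensen with exponent [1 - p/2] gives
    [<v, K^(p/2-1) v> <= <v, K^-1 v>^(1-p/2)], and [<v, K^-1 v> <= x^-2] by [sqr_eigval_inv_le1]. *)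
Lemma sqr_eigval_powR_le p X Y j : 0 < p -> p < 2 -> herm X -> herm Y ->
  eigval X j ^+ 2 * (\sum_i eigval (X *m X + Y *m Y) i `^ (p / 2 - 1) *
                            wt (X *m X + Y *m Y) X i j) <=
  `|eigval X j| `^ p.
Proof.
move=> p0 p2 hX hY; set K := X *m X + Y *m Y.
have [->|x0] := eqVneq (eigval X j) 0.
  by rewrite expr0n mul0r powR_ge0.
have K0 i : 0 <= eigval K i by exact: eigval_sum_sqr_ge0.
have q0 : 0 < 1 - p / 2 by lra.
have q1 : 1 - p / 2 <= 1 by lra.
have x2 : 0 < eigval X j ^+ 2 by rewrite exprn_even_gt0.
have Kinv0 i : 0 <= (eigval K i)^-1 by rewrite invr_ge0.
have h := powR_jensen q0 q1 (fun i => wt_ge0 K X i j) Kinv0 (wt_suml K X j).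
(* This holds for zero eigenvalues too: the inverse of 0 and the nonzero powers of 0 are 0. *)
have -> : \sum_i eigval K i `^ (p / 2 - 1) * wt K X i j =
  \sum_i (eigval K i)^-1 `^ (1 - p / 2) * wt K X i j.
  apply: eq_bigr => i _; congr (_ * _).
  by rewrite -[(eigval K i)^-1]powR_inv1 // -powRrM mulN1r opprB.
apply: (le_trans (ler_wpM2l (ltW x2) h)).
set t := \sum_i _.
have t1 : t <= (eigval X j ^+ 2)^-1.
  by rewrite -[leRHS]mul1r ler_pdivlMr // mulrC sqr_eigval_inv_le1.
have t0 : 0 <= t by apply: sumr_ge0 => i _; rewrite mulr_ge0 ?wt_ge0 ?invr_ge0.
apply: (@le_trans _ _ (eigval X j ^+ 2 * (eigval X j ^+ 2)^-1 `^ (1 - p / 2))).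
  apply: ler_wpM2l; first exact: ltW.
  by apply: ge0_ler_powR; rewrite ?nnegrE ?invr_ge0 ?(ltW x2) ?(ltW q0).
have xn : `|eigval X j| != 0 by rewrite normr_eq0.
rewrite -[eigval X j ^+ 2]real_normK ?num_real // -powR_mulrn // -powRN -powRrM.
rewrite -powRD ?xn ?implybT //.
by rewrite le_eqVlt; apply/orP; left; apply/eqP; congr (_ `^ _); field.
Qed.

(** Rotfel'd's inequality: write [K^(p/2)] as [(X^2 + Y^2) K^(p/2-1)] under the trace and bound the
    two parts eigenvector by eigenvector. *)
Lemma trpow_add_sqr_le p X Y : 0 < p -> p < 2 -> herm X -> herm Y ->
  \sum_i eigval (X *m X + Y *m Y) i `^ (p / 2) <= trpow p X + trpow p Y.
Proof.
move=> p0 p2 hX hY; set K := X *m X + Y *m Y.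
have KYX : K = Y *m Y + X *m X by rewrite addrC.
have -> : \sum_i eigval K i `^ (p / 2) =
  \sum_j eigval X j ^+ 2 * (\sum_i eigval K i `^ (p / 2 - 1) * wt K X i j) +
  \sum_j eigval Y j ^+ 2 * (\sum_i eigval K i `^ (p / 2 - 1) * wt K Y i j).
  have swap (E : 'M[R[i]]_n) :
     \sum_j eigval E j ^+ 2 * (\sum_i eigval K i `^ (p / 2 - 1) * wt K E i j) =
     \sum_i eigval K i `^ (p / 2 - 1) * (\sum_j eigval E j ^+ 2 * wt K E i j).
    under eq_bigr do rewrite mulr_sumr.
    rewrite exchange_big; apply: eq_bigr => i _; rewrite mulr_sumr.
    by apply: eq_bigr => j _; rewrite mulrCA.
  apply: etrans (esym (congr2 +%R (swap X) (swap Y))).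
  rewrite -big_split; apply: eq_bigr => i _ /=.
  rewrite -mulrDr -(eigval_sum_sqr i hX hY) -/K [RHS]mulrC mulr_powRB1 ?eigval_sum_sqr_ge0 //.
  by rewrite divr_gt0.
apply: lerD; apply: ler_sum => j _; first exact: sqr_eigval_powR_le.
by rewrite KYX; exact: sqr_eigval_powR_le.
Qed.

Lemma clarkson_mccarthy p X Y : 0 < p -> p < 2 -> herm X -> herm Y ->
  trpow p (X + Y) + trpow p (X - Y) <= 2 * trpow p X + 2 * trpow p Y.
Proof.
move=> p0 p2 hX hY; set K := X *m X + Y *m Y.
have [q0 q1] : 0 < p / 2 /\ p / 2 <= 1 by split; lra.
rewrite -mulrDr; apply: le_trans (ler_wpM2l (ler0n _ 2) (trpow_add_sqr_le p0 p2 hX hY)).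
(* [m E i] is [<k, E^2 k>] for the [i]-th eigenvector [k] of [K]. Jensen in this basis bounds
   [trpow p E], and the parallelogram identity gives the sum of the two values of [m]. *)
pose m (E : 'M[R[i]]_n) i := \sum_j eigval E j ^+ 2 * wt K E i j.
have m0 E i : 0 <= m E i.
  by apply: sumr_ge0 => j _; rewrite mulr_ge0 ?sqr_ge0 ?wt_ge0.
have le_m E : trpow p E <= \sum_i m E i `^ (p / 2).
  rewrite /trpow (sum_wtr K E); apply: ler_sum => i _.
  have := powR_jensen q0 q1 (wt_ge0 K E i) (fun j => sqr_ge0 (eigval E j)) (wt_sumr K E i).
  apply: le_trans; rewrite le_eqVlt; apply/orP; left; apply/eqP.
  apply: eq_bigr => j _; congr (_ * _).
  rewrite -[eigval E j ^+ 2]real_normK ?num_real // -powR_mulrn // -powRrM.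
  by congr (_ `^ _); field.
apply: le_trans (lerD (le_m _) (le_m _)) _.
rewrite -big_split mulr_sumr; apply: ler_sum => i _ /=.
have mK : m (X + Y) i + m (X - Y) i = 2 * eigval K i.
  have hK : herm K by apply: hermD; exact: herm_sqr.
  have KE := mulmx_parallelogram X Y.
  have mE (E : 'M[R[i]]_n) : herm E -> rc (m E i) = in_basis K (E *m E) i i.
    by move=> hE; rewrite (sqr_diag K i hE).
  have kE : in_basis K K i i = rc (eigval K i).
    by rewrite in_basis_id // !mxE eqxx mulr1n.
  have DE A B : in_basis K (A + B) i i = in_basis K A i i + in_basis K B i i.
    by rewrite in_basisD mxE.
  rewrite mulr_natl mulr2n; apply: (@complexI R).
  transitivity (rc (m (X + Y) i) + rc (m (X - Y) i)); first exact: rmorphD.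
  rewrite (mE _ (hermD hX hY)) (mE _ (hermB hX hY)).
  transitivity (in_basis K K i i + in_basis K K i i); last by rewrite kE -rmorphD.
  apply: etrans (esym (DE _ _)) (etrans _ (DE _ _)).
  exact: (congr1 (fun M => in_basis K M i i) KE).
(* Midpoint concavity of the power [p / 2], as Jensen over two points of weight one half. *)
have := @powR_jensen _ bool (fun=> 2^-1) (fun b => if b then m (X + Y) i else m (X - Y) i) _ q0 q1.
rewrite !big_bool /= -!mulrDl mK => /(_ _ _ _).
have -> : 2 * eigval K i / 2 = eigval K i by field.
have -> : (2^-1 + 2^-1 : R) = 1 by field.
move=> h; rewrite -ler_pdivrMl // mulrC; apply: h => // [_|[]//].
by rewrite invr_ge0.
Qed.

End ClarksonMcCarthy.

(** * Characteristic polynomials of [A B] and [B A] *)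

Section CharPoly.

(** Two block eliminations of [M] compute its determinant: one yields the polynomial of [A B], the
    other that of [B A] up to a factor ['X ^+ n], which cancels. Neither inverts [A] or [B]. *)
Lemma char_poly_mulmxC (F : fieldType) (n : nat) (A B : 'M[F]_n) :
  char_poly (A *m B) = char_poly (B *m A).
Proof.
pose a := map_mx (@polyC F) A; pose b := map_mx (@polyC F) B.
pose M := block_mx ('X%:M) a b 1%:M : 'M[{poly F}]_(n + n).
have cpE (U V : 'M[F]_n) : char_poly (U *m V) =
   \det ('X%:M - map_mx (@polyC F) U *m map_mx (@polyC F) V).
  by rewrite /char_poly /char_poly_mx map_mxM.
have E1 : M *m block_mx 1%:M 0 (- b) 1%:M = block_mx ('X%:M - a *m b) a 0 1%:M.
  rewrite /M mulmx_block !mulmx1 !mulmx0 !mulmxN !mul1mx add0r add0r.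
  by rewrite subrr.
have E2 : block_mx 1%:M 0 (- b) ('X%:M) *m M = block_mx ('X%:M) a 0 ('X%:M - b *m a).
  rewrite /M mulmx_block !mul1mx !mul0mx !mulmx1 !addr0 mulNmx.
  by rewrite !mulNmx scalar_mxC addNr [in RHS]addrC.
have D1 : \det M = char_poly (A *m B).
  rewrite cpE; have /(congr1 determinant) := E1.
  by rewrite det_mulmx det_lblock !det1 !mulr1 det_ublock det1 mulr1.
have D2 : 'X ^+ n * \det M = 'X ^+ n * char_poly (B *m A).
  rewrite cpE; have /(congr1 determinant) := E2.
  by rewrite det_mulmx det_lblock det1 mul1r det_scalar det_ublock det_scalar.
by rewrite -D1; apply: (mulfI _ D2); rewrite expf_neq0 // polyX_eq0.
Qed.

End CharPoly.

(** * The Hermitian dilation and singular values *)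

Section Dilation.
Variables (R : realType) (d : nat).
Local Notation rc := (real_complex R).
Implicit Types (A B : 'M[R[i]]_d) (p : R).

Definition dilation A : 'M[R[i]]_(d + d) := block_mx 0 A (adjmx A) 0.

Lemma dilation_herm A : herm (dilation A).
Proof.
rewrite /herm /dilation {1}/adjmx map_block_mx tr_block_mx !map_mx0 !trmx0.
by congr (block_mx _ _ _ _); exact: adjmxK.
Qed.

Lemma dilationD A B : dilation (A + B) = dilation A + dilation B.
Proof. by rewrite /dilation add_block_mx adjmxD !addr0. Qed.

Lemma dilationZ (r : R) A : dilation (rc r *: A) = rc r *: dilation A.
Proof. by rewrite /dilation scale_block_mx adjmxZ !scaler0. Qed.

Lemma dilationN A : dilation (- A) = - dilation A.
Proof. by rewrite /dilation opp_block_mx adjmxN !oppr0. Qed.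

Lemma dilationB A B : dilation (A - B) = dilation A - dilation B.
Proof. by rewrite dilationD dilationN. Qed.

Lemma dilation0 : dilation 0 = 0.
Proof. by rewrite -[in LHS](subrr 0) dilationB subrr. Qed.

Lemma dilation_sum I (r : seq I) (P : pred I) (F : I -> 'M[R[i]]_d) :
  dilation (\sum_(i <- r | P i) F i) = \sum_(i <- r | P i) dilation (F i).
Proof. by apply: (big_morph dilation); [exact: dilationD|exact: dilation0]. Qed.

Lemma char_poly_fcalc n g (A : 'M[R[i]]_n) :
  char_poly (fcalc g A) = \prod_(x <- [seq rc (g (eigval A i)) | i : 'I_n]) ('X - x%:P).
Proof.
rewrite /fcalc -mulmxA char_poly_mulmxC -mulmxA spectral_mul_adj mulmx1.
rewrite char_poly_trig ?diag_mx_is_trig // big_image /=.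
by apply: eq_bigr => i _; rewrite !mxE eqxx mulr1n.
Qed.

Lemma adj_mul_herm A : herm (adjmx A *m A).
Proof. by rewrite /herm adjmxM adjmxK. Qed.

(** In the eigenbasis of [K], the diagonal entries of [K = A^* A] are the squared row norms of
    [M]. *)
Lemma eigval_adj_mul_ge0 A i : 0 <= eigval (adjmx A *m A) i.
Proof.
set K := adjmx A *m A; pose M := spectralmx K *m adjmx A.
have E : M *m rdiag (fun=> 1) *m adjmx M = rdiag (eigval K).
  have -> : rdiag (fun=> 1) = 1%:M :> 'M[R[i]]_d.
    by apply/matrixP => k l; rewrite !mxE.
  rewrite mulmx1 /M adjmxM adjmxK mulmxA -(mulmxA _ _ A) -/K.
  by rewrite -{2}(fcalc_id (adj_mul_herm A : herm K)) spectral_fcalc.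
have := conj_rdiag_diag M (fun=> 1) i; rewrite E !mxE eqxx mulr1n => /complexI ->.
by apply: sumr_ge0 => j _; rewrite mul1r normc2_ge0.
Qed.

(** [xget] meets its specification once some witness exists: the square roots of the eigenvalues of
    [A^* A]. *)
Lemma singular_valuesP A : is_singular_values A (singular_values A).
Proof.
apply: (xgetPex _ (P := is_singular_values A)).
exists [seq Num.sqrt (eigval (adjmx A *m A) i) | i : 'I_d]; split.
  by move=> x /mapP[i _ ->]; exact: sqrtr_ge0.
rewrite -{1}(fcalc_id (adj_mul_herm A)) char_poly_fcalc !big_image /=.
by apply: eq_bigr => i _; rewrite sqr_sqrtr // eigval_adj_mul_ge0.
Qed.

(** The squared dilation is block diagonal with blocks [A A^*] and [A^* A], which share their
    characteristic polynomial. So its eigenvalues are the squared singular values, each taken twice,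
    and [|x|^p] depends on [x^2] only. *)
Lemma trpow_dilation p A :
  trpow p (dilation A) = 2 * \sum_(x <- singular_values A) x `^ p.
Proof.
have [s0 sE] := singular_valuesP A; set s := singular_values A in s0 sE *.
pose S := [seq rc (x ^+ 2) | x <- s ++ s].
pose L := [seq rc (eigval (dilation A) i ^+ 2) | i : 'I_(d + d)].
have LS : perm_eq L S.
  apply: prod_XsubC_eq; rewrite -(char_poly_fcalc (fun x => x ^+ 2)) -fcalc_sqr; last exact: dilation_herm.
  rewrite /dilation mulmx_block !mul0mx !mulmx0 !addr0 !add0r.
  rewrite /S big_map big_cat /= -sE -{1}char_poly_mulmxC.
  rewrite /char_poly -(det_ublock _ 0); congr determinant.
  by rewrite /char_poly_mx map_block_mx !map_mx0 scalar_mx_block opp_block_mx add_block_mx !oppr0 !addr0.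
have psq (x : R) : (x ^+ 2) `^ (p / 2) = `|x| `^ p.
  rewrite -[x ^+ 2]real_normK ?num_real // -powR_mulrn // -powRrM.
  by congr (_ `^ _); field.
transitivity (\sum_(z <- L) complex.Re z `^ (p / 2)).
  by rewrite big_image /=; apply: eq_bigr => i _; rewrite psq.
rewrite (perm_big _ LS) /= /S big_map big_cat /= -mulr2n mulr_natl.
congr (_ *+ _); rewrite !big_seq; apply: eq_bigr => x xs.
by rewrite psq ger0_norm ?s0.
Qed.

Lemma schattenE p A : schatten p A = (trpow p (dilation A) / 2) `^ p^-1.
Proof.
by rewrite trpow_dilation mulrAC divff ?mul1r // pnatr_eq0.
Qed.

End Dilation.

(* The constant 18 is at most 2 e^4, and it is large enough to absorb the first
   steps, where the only available bound is [k D]. *)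
Definition radius (R : realType) (p D : R) (k : nat) : R :=
  Num.sqrt (18 * (p - 1) * k%:R) * D.

(** * Growth of the greedy sums *)

Section GreedySums.
Variables (R : realType) (n : nat).
Implicit Types (D : R).
Variables (p : R) (Y : nat -> 'M[R[i]]_n).
Hypothesis hY : forall j, herm (Y j).
Local Notation B k := (\sum_(j < k) Y j).
Hypothesis greedy : forall k, retr (fcalc (sgnpow p) (B k) *m Y k) <= 0.

Lemma herm_sum k : herm (B k).
Proof.
elim: k => [|k IH]; last by rewrite big_ord_recr; exact: hermD.
by rewrite big_ord0; apply/matrixP => i j; rewrite !mxE conjc0.
Qed.

(** The greedy condition and convexity give [F(B - Y) >= F(B)] for [F = trpow p]; Clarkson-McCarthy
    then leaves [F(B + Y) <= F(B) + 2 F(Y)]. *)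
Lemma trpow_greedy_le M k : 1 < p -> p < 2 -> (forall j, trpow p (Y j) <= M) ->
  trpow p (B k) <= k%:R * (2 * M).
Proof.
move=> p1 p2 YM; elim: k => [|k IH].
  rewrite big_ord0 mul0r.
  have h0 : herm (0 : 'M[R[i]]_n) by move: (herm_sum 0); rewrite big_ord0.
  have := trpowZ p 0 h0; rewrite scaler0 normr0 powR0 ?mul0r => [->//|].
  by rewrite gt_eqF // (lt_trans ltr01).
rewrite big_ord_recr /=.
have ck := clarkson_mccarthy (lt_trans ltr01 p1) p2 (herm_sum k) (hY k).
have gr := trpow_gradient (ltW p1) (herm_sum k) (hermB (herm_sum k) (hY k)).
have {}gr : trpow p (B k) <= trpow p (B k - Y k).
  apply: le_trans gr; rewrite lerDl addrAC subrr add0r mulmxN retrN.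
  by rewrite mulr_ge0 ?oppr_ge0 ?greedy // (le_trans ler01 (ltW p1)).
have := YM k; rewrite -natr1.
move: IH ck gr; move: (trpow p _) (trpow p _) (trpow p _) (trpow p _) => a b c e; lra.
Qed.

(** The triangle inequality: the sum is [k + 1] times an average, to which Jensen applies. *)
Lemma trpow_sum_le D k : 1 <= p -> 0 <= D -> (forall j, trpow p (Y j) <= D `^ p) ->
  trpow p (B k.+1) <= (k.+1%:R * D) `^ p.
Proof.
move=> p1 D0 YD; have k0 : (k.+1%:R : R) != 0 by rewrite pnatr_eq0.
pose w := (fun _ : 'I_k.+1 => k.+1%:R^-1 : R).
have wB : \sum_j real_complex R (w j) *: Y j = real_complex R k.+1%:R^-1 *: B k.+1.
  by rewrite scaler_sumr.
have -> : B k.+1 = real_complex R k.+1%:R *: \sum_j real_complex R (w j) *: Y j.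
  by rewrite wB scalerA -rmorphM divff // rmorph1 scale1r.
have w1 : \sum_j w j = 1.
  by rewrite sumr_const card_ord -[LHS]mulr_natl divff.
have w0 j : 0 <= w j by rewrite invr_ge0 ler0n.
rewrite trpowZ; last first.
  by rewrite wB; apply: hermZ; exact: herm_sum.
rewrite powRM ?ler0n // ger0_norm ?ler0n // ler_wpM2l ?powR_ge0 //.
apply: le_trans (trpow_jensen p1 (fun j : 'I_k.+1 => hY j) w0 w1) _.
rewrite -[leRHS]mul1r -w1 mulr_suml; apply: ler_sum => j _.
by rewrite ler_wpM2l.
Qed.

Lemma trpow_greedy_step D k : 2 <= p -> 0 < D -> 18 * (p - 1) <= k.+1%:R ->
  (forall j, trpow p (Y j) <= D `^ p) ->
  trpow p (B k) <= radius p D k `^ p -> trpow p (B k.+1) <= radius p D k.+1 `^ p.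
Proof.
move=> p2 D0 kp YD Bk; rewrite leNgt; apply/negP => Bk1.
have p0 : 0 < p by lra.
have pn : p != 0 by rewrite gt_eqF.
have k17 : 17 <= k%:R :> R by move: kp; rewrite -natr1; lra.
have k0 : 0 < k%:R :> R by lra.
have r2 m : radius p D m ^+ 2 = 18 * (p - 1) * m%:R * D ^+ 2.
  by rewrite exprMn sqr_sqrtr // !mulr_ge0 ?ler0n //; lra.
have r0 m : (0 < m)%N -> 0 < radius p D m.
  move=> m0; rewrite mulr_gt0 // sqrtr_gt0 mulr_gt0 ?ltr0n //.
  by apply: mulr_gt0; lra.
(* By contradiction, the too large norm [z] of the new sum serves as the common scale in
   [trpow_smooth]. *)
pose z := trpow p (B k.+1) `^ p^-1.
have zp : z `^ p = trpow p (B k.+1).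
  by rewrite -powRrM mulVf // powRr1 // trpow_ge0.
have rz : radius p D k.+1 < z.
  have := @gt0_ltr_powR R p^-1; rewrite invr_gt0 => /(_ p0) h.
  have := h _ _ _ _ Bk1; rewrite !nnegrE powR_ge0 trpow_ge0 => /(_ erefl erefl).
  by rewrite -powRrM divff // powRr1 // ltW // r0.
have z0 : 0 < z by apply: lt_trans (r0 _ _) rz.
have kk : 0 < k.+1%:R :> R by rewrite ltr0n.
have rk : radius p D k <= z * Num.sqrt (k%:R / k.+1%:R).
  have -> : radius p D k = radius p D k.+1 * Num.sqrt (k%:R / k.+1%:R).
    rewrite /radius [RHS]mulrAC -sqrtrM; last by rewrite !mulr_ge0 ?ler0n //; lra.
    by rewrite -[X in _ = Num.sqrt X * _]mulrA (mulrC k.+1%:R) divfK // gt_eqF.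
  by rewrite ler_wpM2r ?sqrtr_ge0 // ltW.
have u0 : 0 <= k%:R / k.+1%:R :> R by rewrite divr_ge0 ?ler0n.
have rkp : radius p D k `^ p <= z `^ p * (k%:R / k.+1%:R) `^ (p / 2).
  apply: (@le_trans _ _ ((z * Num.sqrt (k%:R / k.+1%:R)) `^ p)).
    apply: ge0_ler_powR; rewrite ?nnegrE ?(ltW p0) ?mulr_ge0 ?sqrtr_ge0 ?(ltW z0) ?(ltW D0) //.
  rewrite powRM ?sqrtr_ge0 ?(ltW z0) // -powR12_sqrt // -powRrM.
  by rewrite (_ : 2^-1 * p = p / 2) // mulrC.
have u1 : (k%:R / k.+1%:R) `^ (p / 2) <= 1.
  have := @ge0_ler_powR R (p / 2); rewrite divr_ge0 ?(ltW p0) // => /(_ erefl) h.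
  have := h (k%:R / k.+1%:R) 1; rewrite !nnegrE u0 ler01 powR1; apply => //.
  by rewrite ler_pdivrMr // mul1r ler_nat.
have FB : trpow p (B k) <= z `^ p.
  apply: le_trans Bk (le_trans rkp _); rewrite -[leRHS]mulr1.
  by rewrite ler_wpM2l ?powR_ge0.
have := trpow_smooth p2 (herm_sum k) (hY k) z0 D0 FB.
rewrite big_ord_recr /= in zp; rewrite zp => /(_ (lexx _) (YD k) (greedy k)).
rewrite -{1}zp.
have zz : z `^ p = z `^ (p - 2) * z ^+ 2.
  rewrite -powR_mulrn ?(ltW z0) // -powRD ?subrK //.
  by rewrite (gt_eqF z0) implybT.
set u := _ `^ (p / 2) in rkp u1 *.
(* Bernoulli for [(k+1)/k] with exponent [p / 2]; it yields [1 - u >= p / (2k + p)]. *)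
have uB : u * (1 + p / 2 * k%:R^-1) <= 1.
  have p21 : 1 <= p / 2 by lra.
  have v0 : 0 <= k.+1%:R / k%:R :> R by rewrite divr_ge0 ?ler0n.
  have := bernoulli_powR p21 v0.
  have -> : k.+1%:R / k%:R - 1 = k%:R^-1 :> R.
    by rewrite -natr1; field; rewrite gt_eqF.
  move=> /(ler_wpM2l (powR_ge0 (k%:R / k.+1%:R) (p / 2))) /le_trans; apply.
  rewrite -powRM // (_ : k%:R / k.+1%:R * (k.+1%:R / k%:R) = 1); last first.
    by rewrite mulrA divfK ?divff // gt_eqF.
  by rewrite powR1.
move=> h.
have {}h : z `^ p <= z `^ p * u + 2 * p * (p - 1) * (z `^ (p - 2) * D ^+ 2).
  by apply: le_trans h _; rewrite lerD2r; exact: le_trans Bk rkp.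
have zpm : 0 < z `^ (p - 2) by rewrite powR_gt0.
have {}h : z ^+ 2 * (1 - u) <= 2 * p * (p - 1) * D ^+ 2.
  rewrite -(ler_pM2l zpm); move: h; rewrite zz.
  move: (z `^ (p - 2)) (z ^+ 2) (D ^+ 2) => a b c; lra.
have z2 : 18 * (p - 1) * k.+1%:R * D ^+ 2 < z ^+ 2.
  by rewrite -r2 ltr_pXn2r // nnegrE ltW // r0.
have u1' : p <= (2 * k%:R + p) * (1 - u).
  have : u * (2 * k%:R + p) <= 2 * k%:R.
    have -> : u * (2 * k%:R + p) = u * (1 + p / 2 * k%:R^-1) * (2 * k%:R).
      by field; rewrite gt_eqF.
    by rewrite -[leRHS]mul1r ler_wpM2r // mulr_ge0 ?ler0n.
  move: (k%:R : R) => a; lra.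
have D2 : 0 < D ^+ 2 by rewrite exprn_gt0.
have kp1 : 0 < 2 * k%:R + p by lra.
have pm1 : 0 < p - 1 by lra.
have {}h : z ^+ 2 * p <= 2 * p * (p - 1) * D ^+ 2 * (2 * k%:R + p).
  apply: (@le_trans _ _ (z ^+ 2 * ((2 * k%:R + p) * (1 - u)))).
    by rewrite ler_wpM2l ?sqr_ge0.
  rewrite mulrCA [leRHS]mulrC ler_wpM2l ?(ltW kp1) //.
have {}h : z ^+ 2 <= (p - 1) * D ^+ 2 * (2 * (2 * k%:R + p)).
  rewrite -(ler_pM2r p0); apply: le_trans h _.
  by rewrite le_eqVlt; apply/orP; left; apply/eqP; ring.
(* The contradiction: [18 (p - 1) <= k + 1] forces [2 (2k + p) <= 18 (k + 1)]. *)
have : (p - 1) * D ^+ 2 * (18 * k.+1%:R) < (p - 1) * D ^+ 2 * (2 * (2 * k%:R + p)).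
  apply: lt_le_trans h; apply: le_lt_trans z2.
  by rewrite le_eqVlt; apply/orP; left; apply/eqP; ring.
apply/negP; rewrite ltr_pM2l ?mulr_gt0 // -leNgt.
by move: kp; rewrite -natr1; lra.
Qed.

(** As long as the index is at most [18 (p - 1)] the triangle inequality suffices; afterwards the
    greedy step takes over. It needs [D > 0], so [D = 0] is treated apart. *)
Lemma trpow_greedy_le_radius D k : 2 <= p -> 0 <= D ->
  (forall j, trpow p (Y j) <= D `^ p) ->
  trpow p (B k.+1) <= radius p D k.+1 `^ p.
Proof.
move=> p2 D0 YD; have p1 : 1 <= p by lra.
have trivial m : m.+1%:R <= 18 * (p - 1) \/ D = 0 ->
    trpow p (B m.+1) <= radius p D m.+1 `^ p.
  move=> mD; apply: le_trans (trpow_sum_le m p1 D0 YD) _.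
  apply: ge0_ler_powR.
  - by rewrite (le_trans ler01).
  - by rewrite nnegrE mulr_ge0 ?ler0n.
  - by rewrite nnegrE mulr_ge0 ?sqrtr_ge0.
  case: mD => [mp|->]; last by rewrite /radius !mulr0.
  rewrite ler_wpM2r // -[leLHS]ger0_norm ?ler0n // -sqrtr_sqr ler_wsqrtr //.
  by rewrite expr2 ler_wpM2r ?ler0n.
move: D0; rewrite le_eqVlt => /predU1P[D0|D0]; first by apply: trivial; right.
elim: k => [|k IH].
  by apply: trivial; left; lra.
have [h|h] := leP (k.+2%:R) (18 * (p - 1)); first by apply: trivial; left.
exact: trpow_greedy_step (ltW h) YD IH.
Qed.

End GreedySums.

(** * Distances within a bounded set and its convex hull *)

Section SchattenDistances.
Variables (R : realType) (d : nat).
Local Notation rc := (real_complex R).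
Implicit Types (X Y A : 'M[R[i]]_d) (p M D : R).

Lemma schatten_le p M A : 0 < p -> 0 <= M ->
  (schatten p A <= M) = (trpow p (dilation A) <= 2 * M `^ p).
Proof.
move=> p0 M0; rewrite schattenE; set F := trpow _ _.
have F0 : 0 <= F / 2 by rewrite divr_ge0 ?trpow_ge0.
rewrite [X in _ = (_ <= X)]mulrC -ler_pdivrMr ?ltr0n //.
apply/idP/idP => h.
  have := ge0_ler_powR (ltW p0) _ _ h; rewrite !nnegrE powR_ge0 M0 => /(_ erefl erefl).
  by rewrite -powRrM mulVf ?gt_eqF // powRr1.
have ip0 : 0 <= p^-1 by rewrite invr_ge0 ltW.
have := ge0_ler_powR ip0 _ _ h; rewrite !nnegrE powR_ge0 F0 => /(_ erefl erefl).
by rewrite -powRrM divff ?gt_eqF // powRr1.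
Qed.

Lemma schatten_ge0 p A : 0 <= schatten p A.
Proof. exact: powR_ge0. Qed.

(** This makes the supremum in [diam] an upper bound. The difference [X - Y] is twice the average of
    [X] and [- Y], so Jensen and homogeneity apply. *)
Lemma schatten_dist_bounded p (S : set 'M[R[i]]_d) : 1 <= p ->
  schatten_bounded p S -> has_ubound [set schatten p (X - Y) | X in S & Y in S].
Proof.
move=> p1 [M SM]; have p0 : 0 < p by apply: lt_le_trans p1.
(* An empty [S] allows a negative [M], hence the absolute value. *)
exists (2 * `|M|) => _ [X SX [Y SY <-]].
have M0 : 0 <= `|M| by [].
have bd Z : S Z -> trpow p (dilation Z) <= 2 * `|M| `^ p.
  by move=> SZ; rewrite -schatten_le //; apply: le_trans (SM _ SZ) (ler_norm _).
rewrite schatten_le ?mulr_ge0 //.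
pose w := fun _ : 'I_2 => 2^-1 : R.
pose V (j : 'I_2) := if j == ord0 then dilation X else rc (-1) *: dilation Y.
have -> : dilation (X - Y) = rc 2 *: \sum_j rc (w j) *: V j.
  have -> : \sum_j rc (w j) *: V j = rc 2^-1 *: \sum_j V j by rewrite scaler_sumr.
  rewrite scalerA -rmorphM divff ?pnatr_eq0 // rmorph1 scale1r.
  by rewrite big_ord_recl big_ord1 /V /= rmorphN1 scaleN1r dilationB.
have hV j : herm (V j).
  by rewrite /V; case: ifP => _; [|apply: hermZ]; exact: dilation_herm.
have bV j : trpow p (V j) <= 2 * `|M| `^ p.
  rewrite /V; case: ifP => _; first exact: bd.
  by rewrite trpowZ ?normrN1 ?powR1 ?mul1r ?bd //; exact: dilation_herm.
have w0 j : 0 <= w j by rewrite invr_ge0.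
have w1 : \sum_j w j = 1 by rewrite big_ord_recl big_ord1 /w; field.
have hsum : herm (\sum_j rc (w j) *: V j).
  by rewrite big_ord_recl big_ord1; apply: hermD; exact/hermZ/hV.
rewrite trpowZ // ger0_norm // powRM // mulrCA ler_wpM2l ?powR_ge0 //.
apply: le_trans (trpow_jensen p1 hV w0 w1) _.
rewrite -[leRHS]mul1r -[X in _ <= X * _]w1 mulr_suml; apply: ler_sum => j _.
by apply: ler_wpM2l; [exact: w0|exact: bV].
Qed.

Lemma conv_dist_le p (S : set 'M[R[i]]_d) A D X : 1 <= p -> 0 <= D ->
  (forall X Y, S X -> S Y -> schatten p (X - Y) <= D) ->
  conv S A -> S X -> trpow p (dilation (X - A)) <= 2 * D `^ p.
Proof.
move=> p1 D0 SD [n [w [Z [SZ [w0 [w1 ->]]]]]] SX.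
have p0 : 0 < p by apply: lt_le_trans p1.
have -> : X - \sum_j rc (w j) *: Z j = \sum_j rc (w j) *: (X - Z j).
  under [RHS]eq_bigr do rewrite scalerBr.
  by rewrite sumrB -scaler_suml -rmorph_sum w1 rmorph1 scale1r.
rewrite dilation_sum; under eq_bigr do rewrite dilationZ.
apply: le_trans (trpow_jensen p1 (fun j => dilation_herm (X - Z j)) w0 w1) _.
rewrite -[leRHS]mul1r -[X in _ <= X * _]w1 mulr_suml; apply: ler_sum => j _.
by rewrite ler_wpM2l // -schatten_le // SD.
Qed.

(** The functional averages to zero over the points [Z j - A]; were it positive at all of them,
    every weight would vanish. *)
Lemma conv_descent (S : set 'M[R[i]]_d) A (G : 'M[R[i]]_(d + d)) : conv S A ->
  exists2 X, S X & retr (G *m dilation (X - A)) <= 0.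
Proof.
move=> [n [w [Z [SZ [w0 [w1 AE]]]]]].
have sum0 : \sum_j w j * retr (G *m dilation (Z j - A)) = 0.
  transitivity (retr (G *m dilation (\sum_j rc (w j) *: (Z j - A)))).
    rewrite dilation_sum mulmx_sumr retr_sum; apply: eq_bigr => j _.
    by rewrite dilationZ -scalemxAr retrZ.
  under eq_bigr do rewrite scalerBr.
  rewrite sumrB -scaler_suml -rmorph_sum w1 rmorph1 scale1r -AE subrr.
  by rewrite dilation0 mulmx0 /retr mxtrace0.
apply: contrapT => no.
have pos j : 0 < retr (G *m dilation (Z j - A)).
  by rewrite ltNge; apply/negP => h; apply: no; exists (Z j).
have wz j : w j = 0.
  move/eqP: sum0; rewrite psumr_eq0 => [|l _]; last by rewrite mulr_ge0 // ltW.
  move=> /allP /(_ j (mem_index_enum _)) /=.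
  by rewrite mulf_eq0 (gt_eqF (pos j)) orbF => /eqP.
by move: w1; rewrite big1 // => /eqP; rewrite eq_sym oner_eq0.
Qed.

End SchattenDistances.

Theorem mainTheorem2 (R : realType) (d : nat) (p : R)
  (S : set 'M[R[i]]_d) (A : 'M[R[i]]_d) :
  ((1 < p /\ p <= 4 / 3) \/ p = 2 \/ 4 <= p) ->
  schatten_bounded p S ->
  conv S A ->
  exists X : nat -> 'M[R[i]]_d,
    (forall n, S (X n)) /\
    forall k : nat, (0 < k)%N ->
      let Ak := (real_complex R k%:R)^-1 *: \sum_(j < k) X j in
      ((1 < p /\ p <= 4 / 3) ->
         schatten p (A - Ak) <=
           2 * expR 2 / (p `^ p^-1) * (k%:R `^ (p^-1 - 1)) * diam p S) /\
      ((p = 2 \/ 4 <= p) ->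
         schatten p (A - Ak) <=
           expR 2 * Num.sqrt (2 * (p - 1) / k%:R) * diam p S).
Proof.
move=> hp bS cA.
have p1 : 1 < p by case: hp => [[]//|[->|]]; lra.
have p0 : 0 < p by lra.
pose D := diam p S.
have SD X Y : S X -> S Y -> schatten p (X - Y) <= D.
  move=> SX SY; apply: ub_le_sup; first exact: schatten_dist_bounded (ltW p1) bS.
  by exists X => //; exists Y.
have D0 : 0 <= D.
  (* The zero functional serves only to extract a point of [S]. *)
  have [X SX _] := conv_descent (0 : 'M_(d + d)) cA.
  exact: le_trans (schatten_ge0 p (X - X)) (SD _ _ SX SX).
have stepP B : exists X, S X /\
    retr (fcalc (sgnpow p) (dilation B) *m dilation (X - A)) <= 0.
  by have [X SX h] := conv_descent (fcalc (sgnpow p) (dilation B)) cA; exists X.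
have [g gP] := choice stepP.
(* Indices start at 0: [X k] is the descent point for the sum of the first [k] differences. *)
pose B k := iter k (fun M => M + (g M - A)) 0.
pose X k := g (B k).
pose Y k := dilation (X k - A).
have BE k : B k = \sum_(j < k) (X j - A).
  by elim: k => [|k IH]; rewrite ?big_ord0 // big_ord_recr -IH.
have YB k : dilation (B k) = \sum_(j < k) Y j by rewrite BE dilation_sum.
have hY j : herm (Y j) by exact: dilation_herm.
have greedy k : retr (fcalc (sgnpow p) (\sum_(j < k) Y j) *m Y k) <= 0.
  by rewrite -YB; have [] := gP (B k).
have Yle j : trpow p (Y j) <= 2 * D `^ p.
  by apply: conv_dist_le SD cA _ => //; [exact: ltW|have [] := gP (B j)].
exists X; split => [k|k k0]; first by have [] := gP (B k).
move=> Ak; have kn : (k%:R : R) != 0 by rewrite pnatr_eq0 -lt0n.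
have kpos : 0 < k%:R :> R by rewrite ltr0n.
have AE : trpow p (dilation (A - Ak)) = k%:R^-1 `^ p * trpow p (\sum_(j < k) Y j).
  have -> : A - Ak = real_complex R (- k%:R^-1) *: B k.
    rewrite BE sumrB sumr_const card_ord scalerBr rmorphN scaleNr scaleNr fmorphV.
    rewrite -scaler_nat -(rmorph_nat (real_complex R)) scalerA mulVf ?fmorph_eq0 //.
    rewrite scale1r.
    by rewrite opprK addrC.
  rewrite dilationZ trpowZ; last exact: dilation_herm.
  by rewrite YB normrN ger0_norm // invr_ge0 ltW.
split=> [[_ p43]|p24].
  rewrite schatten_le //; last by rewrite !mulr_ge0 ?invr_ge0 ?powR_ge0 ?expR_ge0.
  rewrite AE.
  have p2 : p < 2 by lra.
  apply: le_trans (ler_wpM2l (powR_ge0 _ _) (trpow_greedy_le hY greedy k p1 p2 Yle)) _.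
  have rhoE : (2 * expR 2 / p `^ p^-1 * k%:R `^ (p^-1 - 1) * diam p S) `^ p =
      2 `^ p * expR (2 * p) / p * (k%:R * k%:R^-1 `^ p) * D `^ p.
    rewrite !powRM ?mulr_ge0 ?invr_ge0 ?powR_ge0 ?expR_ge0 // -expRM -/D.
    congr (_ * _ * _ * _).
      rewrite -powRN -powRrM mulNr mulVf ?gt_eqF //.
      by rewrite powR_inv1 // ltW.
    rewrite -powRrM mulrBl mulVf ?gt_eqF // mul1r powRB ?kn ?implybT //.
    by rewrite powRr1 ?ler0n // -[k%:R^-1]powR_inv1 ?ler0n // -powRrM mulN1r powRN.
  rewrite rhoE; set K := _ `^ p; set Dp := D `^ p.
  (* The growth bound gives the constant 2 in place of [2^p e^(2p) / p]. *)
  have e1 : 2 * p <= 2 `^ p * expR (2 * p).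
    have h2 : 2 <= 2 `^ p :> R by apply: le1r_powR; rewrite ?(ltW p1) // ler1n.
    have h3 : p <= expR (2 * p) by apply: le_trans (expR_ge1Dx _); lra.
    by apply: ler_pM => //; exact: ltW.
  have -> : K * (k%:R * (2 * (2 * Dp))) = 2 * (2 * (k%:R * K) * Dp) by ring.
  rewrite ler_pM2l // ler_wpM2r ?powR_ge0 // ler_wpM2r ?mulr_ge0 ?powR_ge0 //.
  by rewrite ler_pdivlMr.
have p2 : 2 <= p by case: p24 => [->|]; lra.
rewrite schatten_le //; last by rewrite !mulr_ge0 ?sqrtr_ge0 ?expR_ge0.
(* The factor [2^(1/p)] accounts for the doubled singular values of the dilation. *)
pose D' := 2 `^ p^-1 * D.
have D'p : D' `^ p = 2 * D `^ p.
  by rewrite powRM ?powR_ge0 // -powRrM mulVf ?gt_eqF // powRr1.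
have D'0 : 0 <= D' by rewrite mulr_ge0 ?powR_ge0.
have rle : trpow p (\sum_(j < k) Y j) <= radius p D' k `^ p.
  case: k k0 {Ak kn kpos AE} => // k _.
  by apply: trpow_greedy_le_radius => // j; rewrite D'p.
rewrite AE; apply: le_trans (ler_wpM2l (powR_ge0 _ _) rle) _.
set s := Num.sqrt (2 * (p - 1) / k%:R).
(* Here [18 = 3^2 * 2]; the remaining factor 3 is absorbed by [3 = 1 + 2 <= e^2]. *)
have rE : radius p D' k = k%:R * (3 * s * D').
  have q0 : 0 <= 2 * (p - 1) / k%:R by rewrite divr_ge0 ?ler0n //; lra.
  rewrite /radius !mulrA; congr (_ * _).
  have -> : 18 * (p - 1) * k%:R = (k%:R * 3) ^+ 2 * (2 * (p - 1) / k%:R) by field.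
  by rewrite sqrtrM ?sqr_ge0 // sqrtr_sqr ger0_norm // mulr_ge0.
have rad0 : 0 <= radius p D' k by rewrite mulr_ge0 ?sqrtr_ge0.
rewrite -powRM ?invr_ge0 ?ler0n // rE mulKf //.
have s0 : 0 <= 3 * s by rewrite mulr_ge0 ?sqrtr_ge0.
rewrite (powRM p s0 D'0) D'p mulrCA ler_pM2l //.
rewrite [leRHS]powRM ?mulr_ge0 ?sqrtr_ge0 ?expR_ge0 // ler_wpM2r ?powR_ge0 //.
apply: ge0_ler_powR; rewrite ?nnegrE ?mulr_ge0 ?sqrtr_ge0 ?expR_ge0 ?(ltW p0) //.
rewrite ler_wpM2r ?sqrtr_ge0 //.
have := expR_ge1Dx (2 : R); lra.
Qed.
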